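(* For any $m\in\mathbb{Z}$, $k\in\mathbb{Z}_{\geq 0}$ and $c\in\mathbb{R}$, $$\underline{\mu}^c\left(\left\{\underline z: N^{\leftarrow p}_{m+\frac12}(\underline{z})=k\right\}\right)=\frac{q^{k(c-m)+\frac{k(k-1)}{2}}}{(q;q)_k\,(-q^{c-m};q)_\infty}.$$
   Context: Fix $q\in(0,1)$. For $a\in\mathbb{R}$, $(a;q)_0=1$, $(a;q)_n=\prod_{i=0}^{n-1}(1-aq^i)$ for $n\ge1$, and $(a;q)_\infty=\prod_{i=0}^\infty(1-aq^i)$. For $c\in\mathbb{R}$, the blocking measure $\underline{\mu}^c$ of the asymmetric simple exclusion process (ASEP) is the product probability measure on $\{0,1\}^{\mathbb{Z}}$ under which the coordinates $z_i$, $i\in\mathbb{Z}$, are independent with $\underline\mu^c(z_i=1)=\frac{q^{c-i}}{1+q^{c-i}}$ and $\underline\mu^c(z_i=0)=\frac{1}{1+q^{c-i}}$. For $m\in\mathbb{Z}$, $N^{\leftarrow p}_{m+\frac12}(\underline z)=\sum_{i=-\infty}^m z_i$ is the number of particles at and to the left of site $m$ (finite $\underline\mu^c$-almost surely). *)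

(* Defs.v *)
From HB Require Import structures.
From mathcomp Require Import all_boot all_order all_algebra.
From mathcomp Require Import finmap ring lra.
From mathcomp Require Import all_classical all_reals all_analysis measurable_realfun.

Set Implicit Arguments.
Unset Strict Implicit.
Unset Printing Implicit Defensive.
Import Order.TTheory GRing.Theory Num.Theory.
Import numFieldNormedType.Exports.
Local Open Scope classical_set_scope.
Local Open Scope ring_scope.

Definition qpoch (R : realType) (a q : R) (n : nat) : R :=
  \prod_(i < n) (1 - a * q ^+ i).

Definition qpoch_inf (R : realType) (a q : R) : R :=
  limn (fun n => qpoch a q n).

Definition coordinate_events : set (set (int -> bool)) :=
  [set E | exists (i : int) (B : set bool), E = [set z : int -> bool | B (z i)]].

(* {0,1}^Z with its product sigma-algebra *)
Definition configuration := g_sigma_algebraType coordinate_events.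

Definition mutually_independent (R : realType) (d d' : measure_display)
    (T : measurableType d) (T' : measurableType d') (P : probability T R)
    (I : choiceType) (X : I -> T -> T') : Prop :=
  forall (J : {fset I}) (B : I -> set T'), (forall i, measurable (B i)) ->
  P (\bigcap_(i in [set` J]) (X i @^-1` B i)) =
  (\prod_(i <- J) P (X i @^-1` B i))%E.

Definition is_blocking_measure (R : realType) (q c : R)
    (mu : probability configuration R) : Prop :=
  [/\ mutually_independent mu (fun (i : int) (z : configuration) => z i),
      forall i : int, mu [set z | z i = true] =
        (q `^ (c - i%:~R) / (1 + q `^ (c - i%:~R)))%:E
    & forall i : int, mu [set z | z i = false] =
        (1 / (1 + q `^ (c - i%:~R)))%:E].

(* The sum may be infinite, hence the values in \bar R. *)
Definition particles_left (R : realType) (m : int) (z : configuration) : \bar R :=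
  \esum_(i in [set i : int | i <= m]) ((z i)%:R%:E).

(* Bernoulli(p n) bits obtained from a uniform point x of [0, 1[ by successive
   subdivision: st n x is the rescaled position of x after n subdivisions *)
Module BlockingMeasureExistence.
Section bernoulli_bits.
Variables (R : realType) (p : nat -> R).
Hypothesis hp : forall n, 0 < p n < 1.

Fixpoint st n (x : R) : R :=
  if n is n'.+1 then
    if st n' x < p n' then st n' x / p n' else (st n' x - p n') / (1 - p n')
  else x.

Definition bit n (x : R) : bool := st n x < p n.

Lemma st_itv n x : 0 <= x < 1 -> 0 <= st n x < 1.
Proof.
move=> hx; elim: n => //= n /andP[h0 h1].
have /andP[p0 p1] := hp n.
case: ltP => h.
  by rewrite divr_ge0 ?ltr_pdivrMr ?mul1r ?h// ltW.
have q0 : 0 < 1 - p n by lra.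
by rewrite divr_ge0 ?subr_ge0 ?ltr_pdivrMr ?mul1r ?(ltW q0)//=; lra.
Qed.

Lemma measurable_st n : measurable_fun setT (st n).
Proof.
elim: n => [|n IH] /=; first exact: measurable_id.
apply: measurable_fun_if => //.
- exact: measurable_fun_ltr.
- by apply: measurable_funTS; apply: measurable_funM.
- by apply: measurable_funTS; apply: measurable_funM => //; apply: measurable_funB.
Qed.

Lemma measurable_bit n : measurable_fun setT (bit n).
Proof. by apply: measurable_fun_ltr => //; exact: measurable_st. Qed.

Definition nu n (B : set bool) : R :=
  (if `[< B true >] then p n else 0) + (if `[< B false >] then 1 - p n else 0).

Definition slab n (B : nat -> set bool) s t : set R :=
  [set x | [/\ 0 <= x < 1, forall i, (i < n)%N -> B i (bit i x)
     & s <= st n x < t]].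

Lemma measurable_slab n B s t : measurable (slab n B s t).
Proof.
have -> : slab n B s t = `[0%R, 1%R[%classic `&`
   (\bigcap_(i in [set i | (i < n)%N]) (bit i @^-1` B i) `&` (st n @^-1` `[s, t[%classic)).
  by apply/seteqP; split => x; rewrite /slab/= !in_itv/=; [case|case=> ? []].
apply: measurableI; first exact: measurable_itv.
apply: measurableI.
  apply: bigcap_measurableType.
  by move=> i _; rewrite -[X in measurable X]setTI; exact: measurable_bit.
by rewrite -[X in measurable X]setTI; apply: measurable_st => //; exact: measurable_itv.
Qed.


Lemma slabS n B s t : 0 <= s -> t <= 1 -> slab n.+1 B s t =
  (if `[< B n true >] then slab n B (s * p n) (t * p n) else set0) `|`
  (if `[< B n false >] then
     slab n B (p n + (1 - p n) * s) (p n + (1 - p n) * t) else set0).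
Proof.
move=> s0 t1; have /andP[p0 p1] := hp n; have q0 : 0 < 1 - p n by lra.
have lep a b : (a <= b / p n) = (a * p n <= b) by rewrite ler_pdivlMr.
have ltp a b : (b / p n < a) = (b < a * p n) by rewrite ltr_pdivrMr.
have leq' a b : (a <= (b - p n) / (1 - p n)) = (p n + (1 - p n) * a <= b).
  by rewrite ler_pdivlMr// mulrC lerBrDl.
have ltq a b : ((b - p n) / (1 - p n) < a) = (b < p n + (1 - p n) * a).
  by rewrite ltr_pdivrMr// mulrC ltrBlDl.
apply/seteqP; split => x.
- move=> [hx hB] /=; case: ifP => hy; rewrite ?lep ?ltp ?leq' ?ltq => hst.
  + left; have Bt : B n true by have := hB n (ltnSn n); rewrite /bit hy.
    case: asboolP => // _; split => // i hi; exact: (hB i (ltnW hi)).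
  + right; have Bt : B n false by have := hB n (ltnSn n); rewrite /bit hy.
    case: asboolP => // _; split => // i hi; exact: (hB i (ltnW hi)).
- case; case: asboolP => // Bb [hx hB hst].
  + have hy : st n x < p n by move/andP: hst => [_ /lt_le_trans]; apply; nra.
    split => //=; last by rewrite hy lep ltp.
    move=> i; rewrite ltnS leq_eqVlt => /predU1P[->|]; last exact: hB.
    by rewrite /bit hy.
  + have hy : (st n x < p n) = false.
      by apply/negbTE; rewrite -leNgt; move/andP: hst => [/(le_trans _) + _]; apply; nra.
    split => //=; last by rewrite hy leq' ltq.
    move=> i; rewrite ltnS leq_eqVlt => /predU1P[->|]; last exact: hB.
    by rewrite /bit hy.
Qed.

Lemma lebesgue_slab n B s t : 0 <= s -> s <= t -> t <= 1 ->
  lebesgue_measure (slab n B s t) = ((t - s) * \prod_(i < n) nu i (B i))%:E.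
Proof.
elim: n s t => [|n IH] s t s0 st1 t1.
  rewrite big_ord0 mulr1.
  have -> : slab 0 B s t = `[s, t[%classic.
    apply/seteqP; split => x; rewrite /slab/= in_itv/=; first by case.
    by move=> /andP[h1 h2]; split => //; lra.
  rewrite lebesgue_measure_itv/= lte_fin; case: ltP => // ts.
  by congr EFin; lra.
have /andP[p0 p1] := hp n; have q0 : 0 < 1 - p n by lra.
rewrite slabS// measureU.
- have e1 : lebesgue_measure (slab n B (s * p n) (t * p n)) =
     ((t * p n - s * p n) * \prod_(i < n) nu i (B i))%:E by apply: IH; nra.
  have e2 : lebesgue_measure (slab n B (p n + (1 - p n) * s) (p n + (1 - p n) * t)) =
     ((p n + (1 - p n) * t - (p n + (1 - p n) * s)) * \prod_(i < n) nu i (B i))%:E.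
    by apply: IH; nra.
  rewrite big_ord_recr/= /nu.
  by case: (asboolP (B n true)) => _; case: (asboolP (B n false)) => _;
    rewrite ?measure0 ?e1 ?e2 -?EFinD ?add0e ?adde0 -/(nu _ _); congr EFin; rewrite -/nu; ring.
- by case: ifP => // _; exact: measurable_slab.
- by case: ifP => // _; exact: measurable_slab.
- apply/seteqP; split => x //= -[]; case: ifP => // _ [_ _ h1]; case: ifP => // _ [_ _ h2].
  by move/andP: h1 => [_ h1]; move/andP: h2 => [h2 _]; nra.
Qed.

Definition uprob := mrestr (@lebesgue_measure R) (measurable_itv `[0%R, 1%R[).
HB.instance Definition _ := Measure.on uprob.
Lemma uprob_setT : uprob setT = 1%E.
Proof.
by rewrite /uprob /mrestr setTI lebesgue_measure_itv/= lte_fin ltr01 oppr0 adde0.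
Qed.
HB.instance Definition _ := Measure_isProbability.Build _ _ _ uprob uprob_setT.

Lemma uprob_bits n B : uprob (\bigcap_(i in [set i | (i < n)%N]) (bit i @^-1` B i)) =
  (\prod_(i < n) nu i (B i))%:E.
Proof.
rewrite /uprob /mrestr -[X in X%:E]mul1r -[X in X * _](subr0 1) -lebesgue_slab//.
congr lebesgue_measure; apply/seteqP; split => x; rewrite /slab/= in_itv/=.
  by move=> [hB hx]; split => //; exact: st_itv.
by move=> [hx hB _]; split.
Qed.

Definition bits (x : measurableTypeR R) : configuration := fun i => bit (choice.pickle i) x.

Lemma measurable_bits : measurable_fun setT bits.
Proof.
apply: measurability => // _ [_ [i [B ->]] <-].
by apply: measurable_bit.
Qed.

HB.instance Definition _ := isMeasurableFun.Build _ _ _ _ bits measurable_bits.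

Definition bits_law : probability configuration R := distribution uprob bits.

Lemma nuT n : nu n setT = 1.
Proof. by rewrite /nu !asboolT//; ring. Qed.

Lemma bits_law_cylinder (J : {fset int}) (B : int -> set bool) :
  bits_law (\bigcap_(i in [set` J]) ((fun z : configuration => z i) @^-1` B i)) =
  (\prod_(i <- J) nu (choice.pickle i) (B i))%:E.
Proof.
pose B' n : set bool :=
  if choice.pickle_inv n is Some i then (if i \in J then B i else setT) else setT.
pose N := (\max_(i <- J) choice.pickle i).+1.
have ltN i : i \in J -> (choice.pickle i < N)%N.
  by move=> iJ; rewrite ltnS; exact: (@leq_bigmax_seq _ _ predT (@choice.pickle int)).
have B'E i : i \in J -> B' (choice.pickle i) = B i.
  by move=> iJ; rewrite /B' choice.pickleK_inv iJ.
have B'T n : n \notin [seq choice.pickle i | i <- J] -> B' n = setT.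
  rewrite /B'; case En: (choice.pickle_inv n) => [i|//] nJ.
  case: ifP => // iJ; case/negP: nJ; apply/mapP; exists i => //.
  by have := @choice.pickle_invK int n; rewrite En.

transitivity ((\prod_(n < N) nu n (B' n))%:E); last first.
  congr EFin; apply/esym.
  rewrite (eq_big_seq (fun i => nu (choice.pickle i) (B' (choice.pickle i)))); last first.
    by move=> i iJ; rewrite B'E.
  rewrite -(big_map choice.pickle predT (fun n => nu n (B' n))).
  rewrite -(big_mkord predT (fun n => nu n (B' n))).
  rewrite [RHS](bigID (mem [seq choice.pickle i | i <- J]))/=.
  rewrite [X in _ * X]big1 ?mulr1; last by move=> n nJ; rewrite B'T ?nuT.
  rewrite -[RHS]big_filter; apply: perm_big; apply: uniq_perm.
  - by rewrite map_inj_uniq ?fset_uniq//; exact: (pcan_inj choice.pickleK).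
  - by rewrite filter_uniq ?iota_uniq.
  - move=> n; rewrite mem_filter mem_index_iota/=; apply/idP/idP => [nJ|/andP[]//].
    by rewrite nJ/=; case/mapP: nJ => i iJ ->; exact: ltN.
rewrite -uprob_bits; congr (uprob _); apply/seteqP; split => x /= h.
- move=> n _; rewrite /B'; case En: (choice.pickle_inv n) => [i|//]; case: ifP => // iJ.
  have /= := h i iJ; rewrite /bits.
  by have := @choice.pickle_invK int n; rewrite En/= => ->.
- move=> i iJ; have := h _ (ltN i iJ).
  by rewrite /= B'E.
Qed.

Lemma bits_law1 i (B : set bool) :
  bits_law [set z : configuration | B (z i)] = (nu (choice.pickle i) B)%:E.
Proof.
have := bits_law_cylinder [fset i]%fset (fun=> B).
rewrite big_seq_fset1 => <-; congr (bits_law _).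
by apply/seteqP; split => z /=; [move=> h j /=; rewrite inE => /eqP -> | apply; rewrite /= inE].
Qed.

End bernoulli_bits.
End BlockingMeasureExistence.

(* Non-vacuity of [is_blocking_measure] *)
Lemma blocking_measure_exists (R : realType) (q c : R) : 0 < q ->
  exists mu : probability configuration R, is_blocking_measure q c mu.
Proof.
move=> q0; pose w (i : int) := q `^ (c - i%:~R).
have w0 i : 0 < w i by exact: powR_gt0.
pose p n : R := if choice.pickle_inv n is Some i then w i / (1 + w i) else 2^-1.
have hp n : 0 < p n < 1.
  rewrite /p; case: choice.pickle_inv => [i|]; last by lra.
  have wi := w0 i; have w1 : 0 < 1 + w i by lra.
  by rewrite divr_gt0// ltr_pdivrMr//; lra.
exists (BlockingMeasureExistence.bits_law p); split.
- move=> J B _; rewrite (BlockingMeasureExistence.bits_law_cylinder hp J B) -prodEFin.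
  by apply: eq_bigr => i _; rewrite -(BlockingMeasureExistence.bits_law1 hp i).
- move=> i; rewrite (BlockingMeasureExistence.bits_law1 hp i [set true])/BlockingMeasureExistence.nu /p choice.pickleK_inv.
  by rewrite asboolT// asboolF// addr0.
- move=> i; rewrite (BlockingMeasureExistence.bits_law1 hp i [set false])/BlockingMeasureExistence.nu /p choice.pickleK_inv.
  have wi := w0 i; rewrite asboolF// asboolT// add0r -/(w i).
  by congr EFin; field; lra.
Qed.

(* Main.v *)
(* With x = q^(c - m), the site m - j is occupied with odds x q^j.  By
   independence, the event that k of the n sites m, ..., m - n + 1 are occupied
   and that no site further left is has probability
     e_k(x, x q, ..., x q^(n-1)) / (-x; q)_oo,
   where the elementary symmetric polynomial e_k is given by the q-binomial
   theorem.  These events increase with n to {N = k}, and e_k converges to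
   x^k q^(k(k-1)/2) / (q; q)_k. *)
Require Import Defs.
From mathcomp Require Import all_boot all_order all_algebra.
From mathcomp Require Import finmap ring zify.
From mathcomp Require Import all_classical all_reals all_analysis.

Set Implicit Arguments.
Unset Strict Implicit.
Unset Printing Implicit Defensive.
Import Order.TTheory GRing.Theory Num.Theory.
Import numFieldNormedType.Exports.
Local Open Scope classical_set_scope.
Local Open Scope ring_scope.

(** * Elementary symmetric polynomials of a geometric progression *)

(* The elementary symmetric polynomial e_k(x, x q, ..., x q^(n-1)); for n < k the
   truncated subtraction makes the factor i = n vanish, as it should. *)
Definition qesym (R : realType) (x q : R) (n k : nat) : R :=
  x ^+ k * q ^+ 'C(k, 2) * (\prod_(i < k) (1 - q ^+ (n - i))) / qpoch q q k.

Lemma qpoch_qq_gt0 (R : realType) (q : R) (k : nat) :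
  0 < q < 1 -> 0 < qpoch q q k.
Proof.
move=> /andP[q0 q1]; apply: prodr_gt0 => i _.
by rewrite subr_gt0 -exprS exprn_ilt1 ?ltW.
Qed.

Lemma qpoch_oppE (R : realType) (x q : R) (n : nat) :
  qpoch (- x) q n = \prod_(j < n) (1 + x * q ^+ j).
Proof. by apply: eq_bigr => j _; rewrite mulNr opprK. Qed.

Lemma qesym_0n (R : realType) (x q : R) (k : nat) :
  qesym x q 0 k = (k == 0%N)%:R.
Proof.
rewrite /qesym; case: k => [|k].
  by rewrite /qpoch !big_ord0 /= !expr0 !mul1r invr1.
by rewrite big_ord_recl sub0n expr0 subrr mul0r mulr0 mul0r.
Qed.

Lemma qesym_n0 (R : realType) (x q : R) (n : nat) : qesym x q n 0 = 1.
Proof. by rewrite /qesym /qpoch !big_ord0 /= !expr0 !mul1r invr1. Qed.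

(** Pascal rule for elementary symmetric polynomials: a product of k+1 variables either avoids the
    last variable x q^n or contains it. Here it is checked on the closed form. *)
Lemma qesym_rec (R : realType) (x q : R) (n k : nat) : 0 < q < 1 ->
  qesym x q n.+1 k.+1 =
  qesym x q n k.+1 + x * q ^+ n * qesym x q n k.
Proof.
move=> hq; have qk := lt0r_neq0 (qpoch_qq_gt0 k hq).
have := lt0r_neq0 (qpoch_qq_gt0 k.+1 hq).
rewrite /qesym /qpoch big_ord_recr/= -/(qpoch q q k) mulf_eq0 negb_or.
move=> /andP[_ qk1]; rewrite -exprS in qk1 *.
rewrite binS bin1 exprD big_ord_recl subn0.
rewrite (eq_bigr (fun i : 'I_k => 1 - q ^+ (n - i)))//.
rewrite [X in _ = x ^+ k.+1 * _ * X / _ + _]big_ord_recr/=.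
set p := \prod_(i < k) _; set C := q ^+ 'C(k, 2).
(* Every term is a multiple of [p]. For n < k its factor i = n is zero, so both sides vanish. *)
case: (leqP k n) => [kn|nk]; last first.
  have -> : p = 0 by rewrite /p (bigD1 (Ordinal nk))//= subnn expr0 subrr mul0r.
  by rewrite !(mul0r, mulr0) addr0.
(* Splitting n as k + (n - k) leaves a rational identity in q^k and q^(n-k). *)
rewrite -[in X in 1 - X](subnKC kn) -[in x * q ^+ n](subnKC kn).
rewrite !exprS !exprD in qk1 *; field.
by rewrite qk qk1.
Qed.

(** * Finite windows of sites under the blocking measure *)

Section blocking_measure.
Variables (R : realType) (q : R) (m : int) (c : R).
Variable mu : probability configuration R.
Hypothesis hq : 0 < q < 1.
Hypothesis hmu : is_blocking_measure q c mu.
Let x : R := q `^ (c - m%:~R).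

Let odds_gt0 (j : nat) : 0 < 1 + x * q ^+ j.
Proof.
have /andP[q0 _] := hq.
by rewrite addr_gt0// mulr_gt0 ?powR_gt0// exprn_gt0.
Qed.

Lemma blocking_site (j : nat) (b : bool) :
  mu [set z : configuration | z (m - j%:Z) = b] =
  ((if b then x * q ^+ j else 1) / (1 + x * q ^+ j))%:E.
Proof.
have /andP[q0 _] := hq.
have e : q `^ (c - (m - j%:Z)%:~R) = x * q ^+ j.
  rewrite /x -powR_mulrn ?ltW// -powRD; last by rewrite (lt0r_neq0 q0) implybT.
  by congr (_ `^ _); rewrite rmorphB/= opprB addrCA addrC addrAC.
by case: hmu => _ ht hf; case: b; rewrite ?ht ?hf e.
Qed.

Lemma measurable_site (i : int) (b : bool) :
  measurable [set z : configuration | z i = b].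
Proof. by apply: sub_sigma_algebra; exists i, [set b]. Qed.

(** The pattern [b] is arbitrary, though the limits only use the empty one, because the induction on
    [n] freezes the last counted site as occupied or empty. *)
Definition window (n M k : nat) (b : nat -> bool) : set configuration :=
  [set z : configuration | (\sum_(j < n) z (m - j%:Z)%R)%N = k /\
           forall j, (n <= j < M)%N -> z (m - j%:Z) = b j].

Lemma window0 (M k : nat) (b : nat -> bool) : window 0 M k b =
  if k == 0%N then
    \bigcap_(j in [set j | (j < M)%N]) [set z : configuration | z (m - j%:Z) = b j]
  else set0.
Proof.
apply/seteqP; split => z; rewrite /window/= big_ord0; first by case=> <- h j jM; exact: h.
by case: eqP => [-> h|//]; split => // j /h.
Qed.

Lemma windowS (n M k : nat) (b : nat -> bool) : (n < M)%N ->
  window n.+1 M k b =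
  window n M k (fun j => if j == n then false else b j) `|`
  if k is k'.+1 then window n M k' (fun j => if j == n then true else b j)
  else set0.
Proof.
move=> nM; apply/seteqP; split => z /=.
  move=> []; rewrite big_ord_recr/= => hs hb.
  have hz (v : bool) : z (m - n%:Z) = v -> forall j, (n <= j < M)%N ->
      z (m - j%:Z) = if j == n then v else b j.
    move=> zv j /andP[nj jM]; case: eqP => [->//|/eqP jn].
    by apply: hb; rewrite jM ltn_neqAle eq_sym jn nj.
  case zn: (z (m - n%:Z)) hs; last by rewrite addn0 => hs; left; split => //; exact: hz.
  by rewrite addn1 => <-; right; split => //; exact: hz.
have hw (v : bool) k' : window n M k' (fun j => if j == n then v else b j) z ->
    window n.+1 M (k' + v) b z.
  move=> [hs hb]; have zn : z (m - n%:Z) = v by rewrite hb ?leqnn// eqxx.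
  split; first by rewrite big_ord_recr/= hs zn.
  by move=> j /andP[nj jM]; rewrite hb ?jM ?(ltnW nj)// gtn_eqF.
case; first by move=> /hw; rewrite addn0.
by case: k => // k /hw; rewrite addn1.
Qed.

Lemma measurable_window (n M k : nat) (b : nat -> bool) : (n <= M)%N ->
  measurable (window n M k b).
Proof.
elim: n k b => [|n IH] k b nM.
  rewrite window0; case: ifP => // _.
  by apply: bigcap_measurableType => j _; exact: measurable_site.
rewrite windowS//; apply: measurableU; first by apply: IH; exact: ltnW.
by case: k => // k; apply: IH; exact: ltnW.
Qed.

(** Induction on [n]: with [n] = 0 every site is prescribed and independence gives a product.
    Conditioning on the site m - n then reproduces the recursion [qesym_rec]. *)
Lemma window_prob (n M k : nat) (b : nat -> bool) : (n <= M)%N ->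
  mu (window n M k b) = (qesym x q n k *
    (\prod_(n <= j < M) (if b j then x * q ^+ j else 1)) /
    qpoch (- x) q M)%:E.
Proof.
elim: n k b => [|n IH] k b nM.
  rewrite window0 qesym_0n; case: ifP => _; last by rewrite measure0 !mul0r.
  rewrite mul1r big_mkord qpoch_oppE -prodf_div -prodEFin.
  have inj : injective (fun j : nat => m - j%:Z) by move=> i j /=; lia.
  have [indep _ _] := hmu.
  (* Independence is stated for sets indexed by sites, so the offset j is recovered from the site as
     its distance to m. *)
  have dist (j : nat) : absz (m - (m - j%:Z))%R = j by lia.
  have := indep [fset m - j%:Z | j in iota 0 M]%fset
    (fun i => [set b (absz (m - i)%R)]) (fun=> I).
  rewrite big_imfset/=; last by move=> i j _ _; exact: inj.
  rewrite undup_id ?iota_uniq// -[M in iota 0 M]subn0 big_mkord.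
  under [in X in X -> _]eq_bigr => j _ do rewrite dist.
  rewrite subn0 => h; under eq_bigr => j _ do rewrite -blocking_site.
  rewrite -h; congr (mu _); apply/seteqP; split => z /= {}h.
    by move=> _ /imfsetP[j /= jM ->]; rewrite dist h//=; move: jM; rewrite mem_iota.
  move=> j /= jM; have := h (m - j%:Z); rewrite dist; apply.
  by apply: in_imfset; rewrite /= mem_iota.
have eqw (v : bool) : \prod_(n <= j < M)
      (if (if j == n then v else b j) then x * q ^+ j else 1) =
    (if v then x * q ^+ n else 1) *
      \prod_(n.+1 <= j < M) (if b j then x * q ^+ j else 1).
  rewrite big_ltn// eqxx; congr (_ * _); apply: eq_big_nat => j /andP[nj _].
  by rewrite gtn_eqF.
have step v k' := IH k' (fun j => if j == n then v else b j) (ltnW nM).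
rewrite windowS//; case: k => [|k].
  by rewrite setU0 (step false 0%N) eqw !qesym_n0 !mul1r.
rewrite measureU; first last.
- apply/seteqP; split => z //= -[[_ h0] [_ h1]].
  by have := h0 n; rewrite h1 ?leqnn ?nM// eqxx => /(_ isT).
- by apply: measurable_window; exact: ltnW.
- by apply: measurable_window; exact: ltnW.
by rewrite [X in (X + _)%E]step [X in (_ + X)%E]step !eqw qesym_rec// -EFinD; congr EFin; ring.
Qed.

(** * Convergence of the infinite product *)

(** All factors are at least 1, so the partial products increase. By 1 + t <= e^t and the geometric
    series they stay below exp(x / (1 - q)). *)
Lemma qpoch_inf_cvg : qpoch (- x) q n @[n --> \oo] --> qpoch_inf (- x) q.
Proof.
have /andP[q0 q1] := hq; have x0 : 0 < x by exact: powR_gt0.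
apply: nondecreasing_is_cvgn.
  apply/nondecreasing_seqP => n; rewrite !qpoch_oppE big_ord_recr/= ler_peMr//.
    by apply: prodr_ge0 => j _; exact: ltW.
  by rewrite lerDl mulr_ge0 ?ltW// exprn_gt0.
exists (expR (x / (1 - q))) => _ [n _ <-]; rewrite qpoch_oppE.
have le_exp : \prod_(j < n) (1 + x * q ^+ j) <= expR (\sum_(j < n) x * q ^+ j).
  rewrite expR_sum; apply: ler_prod => j _.
  by rewrite ltW//= expR_ge1Dx.
apply: (le_trans le_exp); rewrite ler_expR.
have := geometric_seriesE x (negbT (lt_eqF q1)) => /(congr1 (fun f => f n)).
rewrite /series/= big_mkord => ->.
rewrite ler_pM2r ?invr_gt0 ?subr_gt0//.
by apply: ler_piMr; rewrite ?gerBl ?exprn_ge0 ?ltW.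
Qed.

Lemma qpoch_inf_gt0 : 0 < qpoch_inf (- x) q.
Proof.
have /andP[q0 q1] := hq.
have x0 : 0 < x by exact: powR_gt0.
rewrite (lt_le_trans ltr01)//; apply: (limr_ge (cvgP _ qpoch_inf_cvg)).
apply: nearW => n; rewrite qpoch_oppE [leLHS](_ : 1 = \prod_(j < n) 1); last by rewrite big1_eq.
apply: ler_prod => j _.
by rewrite ler01 lerDl mulr_ge0 ?exprn_ge0 ?ltW.
Qed.

(** * Configurations with no particle beyond a finite window *)

Definition settled (n k : nat) : set configuration :=
  [set z : configuration | (\sum_(j < n) z (m - j%:Z)%R)%N = k /\
    forall j, (n <= j)%N -> z (m - j%:Z) = false].

Lemma settled_window (n k : nat) :
  settled n k = \bigcap_M window n (n + M) k (fun=> false).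
Proof.
apply/seteqP; split => z /=.
  by move=> [hs h0] M _; split => // j /andP[nj _]; exact: h0.
move=> h; split; first by have [] := h 0%N I.
move=> j nj; have [_ h0] := h (j - n).+1 I; apply: h0.
by rewrite nj addnS subnKC//=.
Qed.

Lemma measurable_settled (n k : nat) : measurable (settled n k).
Proof.
rewrite settled_window; apply: bigcap_measurableType => M _.
by apply: measurable_window; exact: leq_addr.
Qed.

(** Continuity from above: the windows with empty pattern decrease as M grows, and only the
    denominator of their probability depends on M. *)
Lemma settled_prob (n k : nat) :
  mu (settled n k) = (qesym x q n k / qpoch_inf (- x) q)%:E.
Proof.
pose F M := window n (n + M) k (fun=> false).
have mF M : measurable (F M) by apply: measurable_window; exact: leq_addr.
have limF : (mu \o F) M @[M --> \oo] --> mu (settled n k).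
  rewrite settled_window; apply: nonincreasing_cvg_mu => //.
  - by rewrite (le_lt_trans (probability_le1 mu (mF 0%N)))// ltry.
  - by rewrite -settled_window; exact: measurable_settled.
  - move=> M N MN; apply/subsetPset => z [hs h0]; split => // j /andP[nj jM].
    by apply: h0; rewrite nj (leq_trans jM)// leq_add2l.
apply: (cvg_unique _ limF) => //.
have -> : mu \o F = EFin \o (fun M => qesym x q n k / qpoch (- x) q (n + M)).
  apply/funext => M /=; rewrite window_prob ?leq_addr//.
  by rewrite big1_eq mulr1.
apply: cvg_EFin; first exact: nearW.
apply: cvgMr; apply: cvgV; first exact: lt0r_neq0 qpoch_inf_gt0.
under eq_fun do rewrite addnC.
by have := qpoch_inf_cvg; rewrite -(cvg_shiftn n).
Qed.

Lemma particles_left_series (z : configuration) :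
  particles_left R m z = (\sum_(0 <= j <oo) (z (m - j%:Z))%:R%:E)%E.
Proof.
rewrite nneseries_esumT; last by move=> j; rewrite lee_fin.
rewrite /particles_left (@reindex_esum _ _ _ setT _ (fun j : nat => m - j%:Z))//.
split.
- by move=> j _ /=; lia.
- by move=> i j _ _ /=; lia.
- by move=> i /= im; exists (absz (m - i)) => //=; lia.
Qed.

(** The partial counts are integers that increase to k, so they reach k after finitely many sites,
    and no particle can follow. *)
Lemma particles_left_settled (k : nat) :
  [set z : configuration | particles_left R m z = k%:R%:E] =
  \bigcup_n settled n k.
Proof.
have partial (z : configuration) n :
    (\sum_(0 <= j < n) (z (m - j%:Z))%:R%:E)%E =
    ((\sum_(j < n) z (m - j%:Z)%R)%N%:R : R)%:E.
  by rewrite big_mkord sumEFin natr_sum.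
have ge0 (z : configuration) (j : nat) : (0 <= (z (m - j%:Z))%:R%:E :> \bar R)%E.
  by rewrite lee_fin.
apply/seteqP; split => z /=; rewrite particles_left_series.
  move=> hz; pose s n := (\sum_(j < n) z (m - j%:Z)%R)%N.
  have sk n : (s n <= k)%N.
    by rewrite -(ler_nat R) -lee_fin -partial -hz; apply: nneseries_lim_ge.
  have sS n : s n.+1 = (s n + z (m - n%:Z)%R)%N by rewrite /s big_ord_recr.
  have [n nk] : exists n, s n = k.
    apply: contrapT => hs.
    have sk1 n : (s n < k)%N.
      by rewrite ltn_neqAle sk andbT; apply/eqP => e; apply: hs; exists n.
    (* Integer counts that never reach k stay at most k - 1, and so does their limit. The truncation
       at k = 0 is harmless, since [sk1 0] gives k > 0. *)
    have : ((k%:R : R)%:E <= (k.-1%:R)%:E)%E.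
      rewrite -hz; apply: lime_le; first by apply: is_cvg_nneseries.
      apply: nearW => n; rewrite partial lee_fin ler_nat -/(s n).
      by have := sk1 n; lia.
    by rewrite lee_fin ler_nat; have := sk1 0%N; lia.
  have sn j : s (n + j)%N = k.
    elim: j => [|j IH]; first by rewrite addn0.
    by have := sk (n + j).+1; rewrite addnS sS IH; lia.
  exists n => //; split => // j /subnKC <-.
  by have := sS (n + (j - n))%N; rewrite -addnS !sn; case: (z _) => //; lia.
move=> [n _ [hs h0]]; rewrite (nneseries_split 0 n)// add0n partial hs.
by rewrite eseries0 ?adde0// => j nj _; rewrite h0.
Qed.

(** * Letting the window grow *)

Lemma qesym_cvg (k : nat) : qesym x q n k @[n --> \oo] -->
  x ^+ k * q ^+ 'C(k, 2) / qpoch q q k.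
Proof.
have /andP[q0 q1] := hq.
have lim1 (i : nat) : 1 - q ^+ (n - i) @[n --> \oo] --> (1 : R).
  rewrite -[X in _ --> X]subr0; apply: cvgB; first exact: cvg_cst.
  (* Shifting the sequence by i removes the truncated subtraction. *)
  rewrite -(cvg_shiftn i); under eq_fun do rewrite addnK.
  by apply: cvg_expr; rewrite ger0_norm// ltW.
rewrite /qesym; apply: cvgMl; rewrite -[X in _ --> X]mulr1; apply: cvgMr.
elim: k => [|k IH].
  under eq_fun do rewrite big_ord0; exact: cvg_cst.
under eq_fun do rewrite big_ord_recr/=.
have h := cvgM IH (lim1 k); rewrite mulr1 in h. exact: h.
Qed.

(** Continuity from below: a configuration settled after n sites is still settled after n + 1, so
    the probabilities converge to that of the union. *)
Lemma particles_left_prob (k : nat) :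
  mu [set z : configuration | particles_left R m z = k%:R%:E] =
  (x ^+ k * q ^+ 'C(k, 2) / (qpoch q q k * qpoch_inf (- x) q))%:E.
Proof.
have lims : (mu \o settled ^~ k) n @[n --> \oo] --> mu (\bigcup_n settled n k).
  apply: nondecreasing_cvg_mu.
  - by move=> n; exact: measurable_settled.
  - by apply: bigcup_measurable => n _; exact: measurable_settled.
  - apply/nondecreasing_seqP => n; apply/subsetPset => z [hs h0]; split.
      by rewrite big_ord_recr/= hs h0 ?addn0.
    by move=> j nj; apply: h0; exact: ltnW.
rewrite particles_left_settled; apply: (cvg_unique _ lims) => //.
have -> : mu \o settled ^~ k =
    EFin \o (fun n => qesym x q n k / qpoch_inf (- x) q).
  by apply/funext => n /=; exact: settled_prob.
apply: cvg_EFin; first exact: nearW.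
by rewrite invfM mulrA; apply: cvgMl; exact: qesym_cvg.
Qed.

End blocking_measure.

Theorem theorem1p1 (R : realType) (q : R) (hq : 0 < q < 1) (m : int) (k : nat)
    (c : R) (mu : probability configuration R)
    (hmu : is_blocking_measure q c mu) :
  mu [set z : configuration | particles_left R m z = k%:R%:E] =
  (q `^ (k%:R * (c - m%:~R) + k%:R * (k%:R - 1) / 2)
     / (qpoch q q k * qpoch_inf (- q `^ (c - m%:~R)) q))%:E.
Proof.
have /andP[q0 _] := hq.
rewrite (particles_left_prob m hq hmu); congr (_ / _)%:E.
(* The quadratic part of the exponent is a natural number, so the real power of q splits into
   natural powers of x and q. *)
have -> : k%:R * (k%:R - 1) / 2 = ('C(k, 2))%:R :> R.
  elim: k => [|k IH]; first by rewrite !mul0r.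
  by rewrite binS bin1 natrD -IH -natr1; field.
rewrite [RHS]powRD; last by rewrite (lt0r_neq0 q0) implybT.
by rewrite [k%:R * _]mulrC powRrM powR_mulrn ?powR_ge0// powR_mulrn// ltW.
Qed.
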